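(* Let $(M,d)$ be a metric space and let $P\subseteq M$ be a finite set, enumerated as $p_0,\dots,p_n$ by a farthest point sampling with insertion radii $\lambda_0,\dots,\lambda_n$: that is, $p_0\in P$ is arbitrary, $\lambda_0=\infty$, and for each $0<k\le n$ the point $p_k\in P$ is of maximal distance to $\{p_0,\dots,p_{k-1}\}$, and this distance is $\lambda_k$. Let $\varepsilon>0$ and let $\varphi\colon\{0,\dots,n\}\to\{0,\dots,n\}$ be a function with $\varphi(0)=0$, $\varphi(k)<k$ and \[ d(p_k,p_{\varphi(k)})+(\varepsilon+1)\lambda_k/\varepsilon\le(\varepsilon+1)\lambda_{\varphi(k)}/\varepsilon \] for $k=1,\dots,n$. Let $\check{\mathcal C}$ be the relative Čech complex of $P$ in $M$, the filtered simplicial complex whose level $t\in[0,\infty]$ consists of the finite $\sigma\subseteq P$ for which there is $w\in M$ with $d(p,w)<t$ for all $p\in\sigma$. Let $S$ (the Sparse Dowker Nerve) be the filtered subcomplex of $\check{\mathcal C}$ whose level $t$ consists of the subsets $\sigma\subseteq P$ for which there exists $w\in M$ with \[ d(p_k,w)<\min\{t,(\varepsilon+1)\lambda_k/\varepsilon,(\varepsilon+1)\lambda_{\varphi(l)}/\varepsilon\} \] for all $k,l$ with $p_k,p_l\in\sigma$. Then $S$ is multiplicatively $(1,1+\varepsilon)$-interleaved with $\check{\mathcal C}$; explicitly, there are maps $f_t\colon|\check{\mathcal C}_t|\to|S_{(1+\varepsilon)t}|$ such that, writing $g_t\colon S_t\to\check{\mathcal C}_t$ for the inclusions, $f_t\circ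 g_t$ is homotopic to the inclusion $|S_t|\to|S_{(1+\varepsilon)t}|$ and $g_{(1+\varepsilon)t}\circ f_t$ is homotopic to the inclusion $|\check{\mathcal C}_t|\to|\check{\mathcal C}_{(1+\varepsilon)t}|$.
   Context: $|K|$ denotes the geometric realization of a simplicial complex $K$; maps between geometric realizations are continuous maps. Conventions: $\infty\cdot c=\infty$ for $c>0$ and $\min$ includes possibly infinite values. *)

(* Defs.v *)
From HB Require Import structures.
From mathcomp Require Import all_boot all_order all_algebra.
From mathcomp Require Import all_classical all_reals all_analysis.
Set Implicit Arguments. Unset Strict Implicit. Unset Printing Implicit Defensive.
Import Order.TTheory GRing.Theory Num.Theory.
Import numFieldNormedType.Exports.
Local Open Scope classical_set_scope.
Local Open Scope ring_scope.

Definition is_metric {R : realType} {M : Type} (d : M -> M -> R) : Prop :=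
  (forall x y, 0 <= d x y) /\ (forall x y, d x y = 0 <-> x = y) /\
  (forall x y, d x y = d y x) /\ (forall x y z, d x z <= d x y + d y z).

Definition dist_prefix {R : realType} {M : Type} (d : M -> M -> R) {n : nat}
  (p : 'I_n.+1 -> M) (k : nat) (x : M) : \bar R :=
  \big[Order.min/+oo%E]_(i < n.+1 | (i < k)%N) (d x (p i))%:E.

Definition farthest_point_sampling {R : realType} {M : Type} (d : M -> M -> R)
  {n : nat} (p : 'I_n.+1 -> M) (lambda : 'I_n.+1 -> \bar R) : Prop :=
  injective p /\ lambda ord0 = +oo%E /\
  (forall k : 'I_n.+1, (0 < k)%N ->
     (forall j : 'I_n.+1, (dist_prefix d p k (p j) <= dist_prefix d p k (p k))%E) /\
     lambda k = dist_prefix d p k (p k)).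

(* Geometric realization of a simplicial complex K (a family of finite
   vertex sets) on the finite vertex set V: points are barycentric
   coordinate functions V -> R with support a simplex of K; the topology is
   the subspace topology of the product topology on V -> R. *)
Definition geom_real {R : realType} {V : finType} (K : set {set V}) : set {ptws V -> R} :=
  [set x | (forall v, 0 <= x v) /\ \sum_(v : V) x v = 1 /\ K (finset (fun v => x v != 0))].

Definition cont_map {X Y : topologicalType} (A : set X) (B : set Y) (f : X -> Y)
  : Prop := {within A, continuous f} /\ (forall x, A x -> B (f x)).

Definition homotopic_on {R : realType} {X Y : topologicalType} (A : set X)
  (B : set Y) (f g : X -> Y) : Prop :=
  exists H : (R * X)%type -> Y,
    {within [set z | 0 <= z.1 <= 1 /\ A z.2], continuous H} /\
    (forall s x, 0 <= s <= 1 -> A x -> B (H (s, x))) /\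
    (forall x, A x -> H (0, x) = f x) /\
    (forall x, A x -> H (1, x) = g x).

Definition cech {R : realType} {M : Type} (d : M -> M -> R) {n : nat}
  (p : 'I_n.+1 -> M) (t : \bar R) : set {set 'I_n.+1} :=
  [set sigma | exists w : M, forall k, k \in sigma -> ((d (p k) w)%:E < t)%E].

Definition sparse_dowker {R : realType} {M : Type} (d : M -> M -> R) {n : nat}
  (p : 'I_n.+1 -> M) (lambda : 'I_n.+1 -> \bar R) (phi : 'I_n.+1 -> 'I_n.+1)
  (eps : R) (t : \bar R) : set {set 'I_n.+1} :=
  [set sigma | exists w : M, forall k l, k \in sigma -> l \in sigma ->
     ((d (p k) w)%:E < Order.min t (Order.min (((eps + 1) / eps)%:E * lambda k)
                                         (((eps + 1) / eps)%:E * lambda (phi l))))%E].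

(* Main.v *)
Require Import Defs.
From HB Require Import structures.
From mathcomp Require Import all_boot all_order all_algebra.
From mathcomp Require Import all_classical all_reals all_analysis.
From mathcomp Require Import lra.
Set Implicit Arguments. Unset Strict Implicit. Unset Printing Implicit Defensive.
Import Order.TTheory GRing.Theory Num.Theory.
Import numFieldNormedType.Exports.
Local Open Scope classical_set_scope.
Local Open Scope ring_scope.

(** All maps are realizations of vertex maps, and all homotopies are chains of
straight-line homotopies between contiguous ones.  Put c = (eps + 1) / eps and
s = (1 + eps) t.  Farthest point sampling moves every p_k by less than eps t to
some p_(pi k) with lambda_(pi k) >= eps t; then c lambda_(pi k) >= s, so pi maps
the Cech complex at t to S_s, and it is contiguous to the identity in the Cech
complex at s.  For S_t -> S_s, the maps pi and id are contiguous only in the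
larger complex T_s that drops the condition involving phi.  Moving a vertex l
with c lambda_(phi l) < s to phi l, until no such vertex is left, gives a
simplicial map r from T_s to S_s whose restriction to S_s is homotopic to the
identity in S_s.  Hence pi ~ r pi ~ r ~ id in S_s. *)

(** * Continuity in the pointwise topology and concatenation of homotopies *)

Lemma continuous_ptws (T : topologicalType) (V : Type) (R : realType)
  (f : T -> {ptws V -> R}) :
  (forall v, continuous (fun z => f z v)) -> continuous f.
Proof.
move=> cf z; apply/cvg_sup => v.
(* Evaluation at [v] is onto, as constant functions show. *)
apply/cvg_image; first by rewrite eqEsubset; split=> y // _; exists (cst y).
move=> W Wn; exists (@^~ v @^-1` W).
  exact: cf Wn.
by rewrite eqEsubset; split=> [_ [x ? <-]//|y Wy]; exists (cst y).
Qed.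

Lemma continuous_ptws_eval (V : choiceType) (R : realType) (v : V) :
  continuous (fun x : {ptws V -> R} => x v).
Proof. exact: proj_continuous. Qed.

Lemma continuous_pair_fst (R : realType) (X : topologicalType) (a : R -> R) :
  continuous a -> continuous (fun z : R * X => (a z.1, z.2)).
Proof.
move=> ca z.
apply: (@cvg_pair _ _ _ (nbhs z) (nbhs (a z.1)) (nbhs z.2) _ _ _
  (fun z : R * X => a z.1) (fun z : R * X => z.2)).
  apply: (@continuous_comp _ _ _ (fun z : R * X => z.1) a); last exact: ca.
  exact: cvg_fst.
exact: cvg_snd.
Qed.

(* Unlike in [homotopic_on], [H] is continuous on the whole product. *)
Definition homotopic_glob {R : realType} {V : choiceType}
  (A B : set {ptws V -> R}) (f g : {ptws V -> R} -> {ptws V -> R}) : Prop :=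
  exists H : R * {ptws V -> R} -> {ptws V -> R},
    [/\ continuous H,
        forall s x, 0 <= s <= 1 -> A x -> B (H (s, x)),
        forall x, A x -> H (0, x) = f x &
        forall x, A x -> H (1, x) = g x].

Section Homotopy.
Context {R : realType} {V : choiceType}.
Notation X := {ptws V -> R}.
Implicit Types (A B : set X) (f g h : X -> X).

Lemma homotopic_globW A B f g : homotopic_glob A B f g -> homotopic_on (R := R) A B f g.
Proof.
move=> [H [cH HB H0 H1]]; exists H; split=> //.
exact: continuous_subspaceT.
Qed.

Lemma homotopic_glob_sym A B f g : homotopic_glob A B f g -> homotopic_glob A B g f.
Proof.
move=> [H [cH HB H0 H1]]; exists (fun z => H (1 - z.1, z.2)); split.
- move=> z; apply: (@continuous_comp _ _ _ (fun z : R * X => (1 - z.1, z.2)) H);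
    last exact: cH.
  apply: (@continuous_pair_fst _ _ (fun s => 1 - s)) => s.
  by apply: cvgB; [exact: cvg_cst|exact: cvg_id].
- by move=> s x s01; apply: HB => /=; lra.
- by move=> x Ax /=; rewrite subr0 H1.
- by move=> x Ax /=; rewrite subrr H0.
Qed.

Lemma homotopic_glob_trans A B f g h :
  homotopic_glob A B f g -> homotopic_glob A B g h -> homotopic_glob A B f h.
Proof.
move=> [H [cH HB H0 H1]] [K [cK KB K0 K1]].
(* [m1] runs through [H] and then rests at time 1; [m2] rests at time 0 and then runs through [K];
   [m3] stays at the start of [K]. *)
pose m1 (z : R * X) : R * X := (Num.min (2 * z.1) 1, z.2).
pose m2 (z : R * X) : R * X := (Num.max (2 * z.1 - 1) 0, z.2).
pose m3 (z : R * X) : R * X := (0, z.2).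
have c2 : continuous (fun s : R^o => 2 * s : R^o) by exact: mulrl_continuous.
have cm1 : continuous m1.
  apply: (@continuous_pair_fst _ _ (fun s : R^o => Num.min (2 * s : R^o) 1)) => s.
  by apply: continuous_min; [exact: c2 | exact: cvg_cst].
have cm2 : continuous m2.
  apply: (@continuous_pair_fst _ _ (fun s : R^o => Num.max (2 * s - 1 : R^o) 0)) => s.
  apply: (@continuous_max _ _ (fun s : R^o => 2 * s - 1) (fun=> 0));
    last exact: cvg_cst.
  by apply: cvgB; [exact: c2 | exact: cvg_cst].
have cm3 : continuous m3.
  by apply: (@continuous_pair_fst _ _ (fun s : R => 0)) => s; exact: cvg_cst.
(* Adding the two halves and subtracting the common value [g x] glues them
   without a case split, which keeps the result globally continuous. *)
pose J z : X := fun v => H (m1 z) v + K (m2 z) v - K (m3 z) v.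
have J1 s x : s <= 2^-1 -> A x -> J (s, x) = H (2 * s, x).
  move=> s2 Ax; rewrite /J /m1 /m2 /m3 /=.
  have -> : Num.min (2 * s) 1 = 2 * s by apply: min_l; lra.
  have -> : Num.max (2 * s - 1) 0 = 0 :> R by apply: max_r; lra.
  by apply/funext => v; rewrite addrK.
have J2 s x : 2^-1 <= s -> A x -> J (s, x) = K (2 * s - 1, x).
  move=> s2 Ax; rewrite /J /m1 /m2 /m3 /=.
  have -> : Num.min (2 * s) 1 = 1 :> R by apply: min_r; lra.
  have -> : Num.max (2 * s - 1) 0 = 2 * s - 1 by apply: max_l; lra.
  by rewrite H1 // K0 //; apply/funext => v; rewrite addrC addKr.
exists J; split.
- apply: continuous_ptws => v z.
  have ev (L : R * X -> X) (m : R * X -> R * X) :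
      continuous L -> continuous m -> (fun z => L (m z) v) @ z --> L (m z) v.
    move=> cL cm; apply: (@continuous_comp _ _ _ (L \o m) (fun x : X => x v)).
      by apply: continuous_comp; [exact: cm | exact: cL].
    exact: continuous_ptws_eval.
  have e1 := ev H m1 cH cm1; have e2 := ev K m2 cK cm2; have e3 := ev K m3 cK cm3.
  exact: (cvgB (cvgD e1 e2) e3).
- move=> s x s01 Ax; have [s2|s2] := leP s 2^-1.
    by rewrite J1 //; apply: HB => //; lra.
  by rewrite J2 ?ltW //; apply: KB => //; lra.
- by move=> x Ax; rewrite J1 ?invr_ge0 // mulr0 H0.
- move=> x Ax; rewrite J2 //; last lra.
  by rewrite (_ : 2 * 1 - 1 = 1 :> R) ?K1 //; lra.
Qed.
End Homotopy.

(** * Realizations of vertex maps, and contiguity *)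

Section Realization.
Context {R : realType} {V : finType}.
Notation X := {ptws V -> R}.
Implicit Types (K L : set {set V}) (a b : V -> V).

(** The realization of the vertex map [a], as the pushforward of barycentric weights. *)
Definition push a (x : X) : X := fun v => \sum_(u | a u == v) x u.

Lemma push_id (x : X) : push id x = x.
Proof. by apply/funext => v; rewrite /push big_pred1_eq. Qed.

Lemma sum_push a (x : X) : \sum_v push a x v = \sum_v x v.
Proof. by rewrite [RHS](partition_big a xpredT). Qed.

Lemma push_ge0 a (x : X) : (forall v, 0 <= x v) -> forall v, 0 <= push a x v.
Proof. by move=> x0 v; apply: sumr_ge0. Qed.

Lemma push_neq0 a (x : X) v :
  push a x v != 0 -> v \in a @: finset (fun u => x u != 0).
Proof.
apply: contraNT => va; apply/eqP/big1 => u /eqP uv.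
apply/eqP; apply: contraNT va => xu.
by rewrite -uv imset_f // inE.
Qed.

Lemma continuous_push a : continuous (push a).
Proof.
apply: continuous_ptws => v; rewrite /push.
apply: (@continuous_big R V +%R 0 (fun u => a u == v) _ X _ (fun u x => x u)).
  exact: add_continuous.
by move=> u _; exact: continuous_ptws_eval.
Qed.

Definition down_closed L := forall s t : {set V}, (s \subset t)%SET -> L t -> L s.

(** For [a = b] this says that [a] is simplicial from [K] to [L]. *)
Definition contiguous K L a b :=
  forall s : {set V}, K s -> L (a @: s :|: b @: s)%SET.

(** If [x] has support [s], the segment from [push a x] to [push b x] stays in the simplex spanned
    by the images of [s] under [a] and [b]. Supports may be smaller than that simplex, whence
    [down_closed]. *)
Lemma contiguous_homotopic K L a b : down_closed L -> contiguous K L a b ->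
  homotopic_glob (geom_real (R := R) K) (geom_real (R := R) L) (push a) (push b).
Proof.
move=> dL cab.
pose H (z : R * X) : X := fun v => (1 - z.1) * push a z.2 v + z.1 * push b z.2 v.
have cpush (c : V -> V) v : continuous (fun z : R * X => push c z.2 v).
  move=> z; apply: (@continuous_comp _ _ _ (fun z : R * X => push c z.2) (fun x : X => x v)).
    apply: (@continuous_comp _ _ _ (fun z : R * X => z.2) (push c)).
      exact: cvg_snd.
    exact: continuous_push.
  exact: continuous_ptws_eval.
have c0 : continuous (fun z : R * X => z.1) by move=> z; exact: cvg_fst.
have c1 : continuous (fun z : R * X => 1 - z.1).
  move=> z; apply: (@continuous_comp _ _ _ (fun z : R * X => z.1) (fun s : R => 1 - s)).
    exact: c0.
  by apply: cvgB; [exact: cvg_cst | exact: cvg_id].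
exists H; split.
- apply: continuous_ptws => v z.
  exact: (cvgD (cvgM (c1 z) (cpush a v z)) (cvgM (c0 z) (cpush b v z))).
- move=> s x /andP[s0 s1] [x0 [x1 Kx]]; split.
    by move=> v; rewrite addr_ge0 // mulr_ge0 ?subr_ge0 // push_ge0.
  split; first by rewrite big_split /= -!mulr_sumr !sum_push x1 !mulr1 subrK.
  apply: dL (cab _ Kx); apply/fintype.subsetP => v; rewrite inE => Hv; rewrite inE.
  apply/orP; have [/push_neq0|/negPn/eqP a0] := boolP (push a x v != 0); first by left.
  right; apply: push_neq0; apply: contraNneq Hv => b0.
  by rewrite /H /= a0 b0 !mulr0 addr0.
- by move=> x _; apply/funext => v; rewrite /H /= subr0 mul1r mul0r addr0.
- by move=> x _; apply/funext => v; rewrite /H /= subrr mul0r mul1r add0r.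
Qed.
End Realization.

(** * The sparse nerve at one level and the retraction onto it *)

Section SparseNerve.
Context {R : realType} {M : Type} (d : M -> M -> R) {n : nat}.
Context (p : 'I_n.+1 -> M) (phi : 'I_n.+1 -> 'I_n.+1).
Context (lambda : 'I_n.+1 -> \bar R) (eps : R).
Hypothesis dm : is_metric d.
Hypothesis phi0 : phi ord0 = ord0.
Hypothesis phi_lt : forall k : 'I_n.+1, (0 < k)%N -> (phi k < k)%N.
Let L k := (((eps + 1) / eps)%:E * lambda k)%E.
Hypothesis L0 : L ord0 = +oo%E.
Hypothesis L_anti : forall i j : 'I_n.+1, (i <= j)%N -> (L j <= L i)%E.
Hypothesis L_phi : forall k : 'I_n.+1, (0 < k)%N ->
  ((d (p k) (p (phi k)))%:E + L k <= L (phi k))%E.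
Notation S := (sparse_dowker d p lambda phi eps).

Lemma sparse_down s : down_closed (S s).
Proof.
move=> u v /fintype.subsetP uv [w vw]; exists w => k l ku lu.
by apply: vw; exact: uv.
Qed.

Lemma phi_le (k : 'I_n.+1) : (phi k <= k)%N.
Proof.
have [k0|/phi_lt /ltnW//] := posnP k.
by rewrite (_ : k = ord0) ?phi0 //; exact: val_inj.
Qed.

(** By [L_phi] and the triangle inequality, the ball of radius [L k] about [p k] lies in the ball of
    radius [L (phi k)] about [p (phi k)]. So moving a vertex to its parent keeps the witness. *)
Lemma L_phi_lt k w : ((d (p k) w)%:E < L k -> (d (p (phi k)) w)%:E < L (phi k))%E.
Proof.
have [k0|k0] := posnP k.
  by rewrite (_ : k = ord0) ?phi0 //; exact: val_inj.
move=> kw; apply: lt_le_trans (L_phi k0).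
apply: (@le_lt_trans _ _ ((d (p k) (p (phi k)))%:E + (d (p k) w)%:E)%E).
  rewrite -EFinD lee_fin; have [_ [_ [dC dT]]] := dm.
  by rewrite (dC (p k) (p (phi k))).
by rewrite lteD2lE.
Qed.

Section Collapse.
Variable s : \bar R.

(** The second test selects the vertices whose [phi]-condition is stricter than the bound by [s]. *)
Definition collapse v (k : 'I_n.+1) : 'I_n.+1 :=
  if (phi k == v :> nat) && (L (phi k) < s)%E then phi k else k.

(* The vertices are moved in decreasing order of [phi k]: when [k] is moved to
   [phi k = v], every other vertex [j] has [phi j <= v] or [s <= L (phi j)], so
   that the same witness serves for the enlarged simplex. *)
Fixpoint retract v (k : 'I_n.+1) : 'I_n.+1 :=
  if v is v'.+1 then retract v' (collapse v' k) else k.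

(** Loop invariant of [retract]: it is vacuous for [v = n.+1], and for [v = 0] it says
    [s <= L (phi k)]. *)
Definition collapsed v (k : 'I_n.+1) := (L (phi k) < s)%E -> (phi k < v)%N.

Lemma collapse_collapsed v k : collapsed v.+1 k -> collapsed v (collapse v k).
Proof.
rewrite /collapsed /collapse => kv; case: ifPn.
  move=> /andP[/eqP kv' ls].
  (* The parent is not 0, because [L ord0] is infinite; hence [phi] strictly lowers it once more. *)
  have k0 : (0 < phi k)%N.
    rewrite lt0n; apply: contraTneq ls => k0.
    by rewrite (_ : phi k = ord0) ?L0 ?ltNge ?leey //; exact: val_inj.
  by rewrite -kv' => _; exact: phi_lt.
rewrite negb_and => kN ls; move: kN (kv ls).
by rewrite ls orbF ltnS leq_eqVlt => /negPf ->.
Qed.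

Lemma retract_collapsed v k : collapsed v k -> collapsed 0 (retract v k).
Proof. by elim: v k => //= v IH k /collapse_collapsed /IH. Qed.

(** A vertex moves only if its new radius is below [s], so the bound by that radius implies the one
    by [s]. *)
Lemma collapse_near v k w : ((d (p k) w)%:E < Order.min s (L k))%E ->
  ((d (p (collapse v k)) w)%:E < Order.min s (L (collapse v k)))%E.
Proof.
rewrite /collapse; case: ifPn => // /andP[_ ls].
rewrite !lt_min => /andP[_ /L_phi_lt kw].
by rewrite kw (lt_trans kw).
Qed.

Lemma retract_near v k w : ((d (p k) w)%:E < Order.min s (L k))%E ->
  ((d (p (retract v k)) w)%:E < Order.min s (L (retract v k)))%E.
Proof. by elim: v k => //= v IH k kw; apply: IH; exact: collapse_near. Qed.

(** The witness never changes, and at the end [s <= L (phi l)] for every image vertex [l], so the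
    [phi]-condition follows from the bound by [s]. *)
Lemma sparse_retract (u : {set 'I_n.+1}) w :
  (forall k, k \in u -> ((d (p k) w)%:E < Order.min s (L k))%E) ->
  S s (retract n.+1 @: u)%SET.
Proof.
move=> uw; exists w => _ _ /imsetP[k ku ->] /imsetP[l lu ->].
have /(retract_near n.+1) := uw _ ku; rewrite !lt_min => /andP[ks ->].
rewrite ks /= (lt_le_trans ks) // leNgt; apply/negP.
by move/(@retract_collapsed n.+1 l (fun=> ltn_ord _)).
Qed.

Lemma collapse_contiguous (K : set {set 'I_n.+1}) c v :
  contiguous K (S s) c c -> (forall k, collapsed v.+1 (c k)) ->
  contiguous K (S s) c (collapse v \o c).
Proof.
move=> cS cv u /cS [w]; rewrite finset.setUid => uw.
pose U := (c @: u)%SET.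
pose moved k := exists2 j, j \in U & [/\ k = phi j, k = v :> nat & (L k < s)%E].
have UP k : k \in (c @: u :|: (collapse v \o c) @: u)%SET -> k \in U \/ moved k.
  rewrite inE => /orP[|/imsetP[j ju ->]]; first by left.
  rewrite /= /collapse; case: ifPn; last by left; apply: imset_f.
  by move=> /andP[/eqP jv ls]; right; exists (c j) => //; apply: imset_f.
have near k : k \in U \/ moved k -> ((d (p k) w)%:E < s)%E /\ ((d (p k) w)%:E < L k)%E.
  case=> [kU|[j jU [-> _ ls]]].
    by have := uw _ _ kU kU; rewrite !lt_min => /and3P[].
  have := uw _ _ jU jU; rewrite !lt_min => /and3P[_ /L_phi_lt jw _].
  by split=> //; exact: lt_trans ls.
exists w => k l /UP kU /UP lU; rewrite !lt_min -/(L k) -/(L (phi l)).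
have [-> kL] := near _ kU; rewrite kL /=.
(* What remains is the bound by [L (phi l)]. For [l] old and [k] moved, either [s <= L (phi l)] or
   the invariant gives [phi l <= v = k]. For [l = phi j] moved and [k] old, the condition for [k]
   and [j] bounds the distance by [L l]. If both are moved, [k = l = v]. *)
case: lU kU => [lU|[j jU [-> jv js]]] [kU|[i iU [ki kv ks]]].
- by have := uw _ _ kU lU; rewrite !lt_min => /and3P[].
- have [ls|sl] := ltP (L (phi l)) s; last first.
    by apply: lt_le_trans sl; have [] := near k; first by right; exists i.
  apply: lt_le_trans kL _; apply: L_anti; rewrite kv.
  by case/imsetP: lU ls => j _ ->; exact: cv.
- have := uw _ _ kU jU; rewrite !lt_min => /and3P[_ _ kj].
  by apply: lt_le_trans kj _; apply: L_anti; exact: phi_le.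
- apply: lt_le_trans kL _; apply: L_anti; apply: leq_trans (phi_le _) _.
  by rewrite jv kv.
Qed.

(** The map [c] is arbitrary so that the induction on [v] can absorb each [collapse] into it; the
    cases needed later are [pi] and [id]. *)
Lemma retract_homotopic (K : set {set 'I_n.+1}) c v :
  contiguous K (S s) c c -> (forall k, collapsed v (c k)) ->
  homotopic_glob (geom_real (R := R) K) (geom_real (R := R) (S s))
    (push c) (push (retract v \o c)).
Proof.
elim: v c => [|v IH] c cS cv.
  exact: contiguous_homotopic (@sparse_down s) cS.
have cc := collapse_contiguous cS cv.
apply: homotopic_glob_trans (contiguous_homotopic (@sparse_down s) cc) _.
apply: (IH (collapse v \o c)) => [u Ku|k]; last exact: collapse_collapsed.
rewrite finset.setUid; apply: sparse_down (cc _ Ku); exact: finset.subsetUr.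
Qed.
End Collapse.
End SparseNerve.

(** * Monotonicity and covering properties of farthest point sampling *)

Section FarthestPoint.
Context {R : realType} {M : Type} (d : M -> M -> R) {n : nat}.
Context (p : 'I_n.+1 -> M) (lambda : 'I_n.+1 -> \bar R).
Hypothesis fps : farthest_point_sampling d p lambda.

(** [p j] already competes at stage [i], and its distance to a longer prefix can only be smaller. *)
Lemma insertion_radius_anti (i j : 'I_n.+1) :
  (i <= j)%N -> (lambda j <= lambda i)%E.
Proof.
have [_ [l0 lk]] := fps.
have [i0 _|i0 ij] := posnP i.
  by rewrite (_ : i = ord0) ?l0 ?leey //; exact: val_inj.
have [_ ->] := lk j (leq_trans i0 ij).
have [li ->] := lk i i0.
apply: le_trans (li j); rewrite /dist_prefix.
apply: sub_bigmin => // k ki; exact: leq_trans ki ij.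
Qed.

(** Let [m] be the first index with radius below [r]. By maximality of [p m], every point is within
    [lambda m] of an earlier one, and all earlier radii are at least [r]. *)
Lemma near_large_radius (r : \bar R) (k : 'I_n.+1) :
  (r <= lambda k)%E \/
  exists2 i, (r <= lambda i)%E & ((d (p k) (p i))%:E < r)%E.
Proof.
have [_ [l0 lk]] := fps.
have [|kr] := leP r (lambda k); [by left | right].
have [m mr mmin] := @arg_minnP _ k (fun i => lambda i < r)%E (fun i => i : nat) kr.
have m0 : (0 < m)%N.
  rewrite lt0n; apply: contraTneq mr => m0.
  by rewrite (_ : m = ord0) ?l0 ?ltNge ?leey //; exact: val_inj.
have [mk lm] := lk m m0.
have : (dist_prefix d p m (p k) < r)%E by apply: le_lt_trans (mk k) _; rewrite -lm.
rewrite /dist_prefix => /bigmin_ltP [|[i im ir]].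
  by rewrite ltNge leey.
exists i => //; rewrite leNgt; apply: contraL im => /mmin.
by rewrite -leqNgt.
Qed.
End FarthestPoint.

(** * The interleaving *)

Lemma ge_scaled_radius (R : realType) (eps : R) (t l : \bar R) : 0 < eps ->
  (eps%:E * t <= l)%E -> ((1 + eps)%:E * t <= ((eps + 1) / eps)%:E * l)%E.
Proof.
move=> e0 tl; have -> : 1 + eps = (eps + 1) / eps * eps by rewrite divfK ?gt_eqF // addrC.
by rewrite EFinM -muleA lee_wpmul2l // lee_fin divr_ge0 // ltW // addr_gt0.
Qed.

Theorem theorem1p1 (R : realType) (M : Type) (d : M -> M -> R) (n : nat)
  (p : 'I_n.+1 -> M) (lambda : 'I_n.+1 -> \bar R) (eps : R)
  (phi : 'I_n.+1 -> 'I_n.+1) :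
  is_metric d ->
  farthest_point_sampling d p lambda ->
  0 < eps ->
  phi ord0 = ord0 ->
  (forall k : 'I_n.+1, (0 < k)%N ->
     (phi k < k)%N /\
     ((d (p k) (p (phi k)))%:E + ((eps + 1) / eps)%:E * lambda k
        <= ((eps + 1) / eps)%:E * lambda (phi k))%E) ->
  forall t : \bar R, (0 <= t)%E ->
  exists f : {ptws 'I_n.+1 -> R} -> {ptws 'I_n.+1 -> R},
    cont_map (geom_real (R := R) (cech d p t))
             (geom_real (R := R) (sparse_dowker d p lambda phi eps ((1 + eps)%:E * t))) f /\
    homotopic_on (R := R) (geom_real (R := R) (sparse_dowker d p lambda phi eps t))
             (geom_real (R := R) (sparse_dowker d p lambda phi eps ((1 + eps)%:E * t))) f id /\
    homotopic_on (R := R) (geom_real (R := R) (cech d p t))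
             (geom_real (R := R) (cech d p ((1 + eps)%:E * t))) f id.
Proof.
move=> dm fps e0 phi0 hphi t t0.
have [d0 [_ [dC dT]]] := dm.
set s := ((1 + eps)%:E * t)%E.
set c := (eps + 1) / eps; pose L k := (c%:E * lambda k)%E.
have c0 : 0 < c by rewrite divr_gt0 // addr_gt0.
have L0 : L ord0 = +oo%E by rewrite /L (proj1 (proj2 fps)) mulry gtr0_sg // mul1e.
have L_anti (i j : 'I_n.+1) : (i <= j)%N -> (L j <= L i)%E.
  by move=> ij; rewrite lee_wpmul2l ?lee_fin ?(ltW c0) //; apply: (insertion_radius_anti fps).
have phi_lt (k : 'I_n.+1) : (0 < k)%N -> (phi k < k)%N by move/hphi => [].
have L_phi (k : 'I_n.+1) : (0 < k)%N -> ((d (p k) (p (phi k)))%:E + L k <= L (phi k))%E.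
  by move/hphi => [].
have ts : (t <= s)%E.
  by rewrite /s -[X in (X <= _)%E]mul1e lee_wpmul2r // lee_fin lerDl ltW.
(* The threshold is chosen since [c * eps = 1 + eps], so [c] scales it to [s]. A move by less than
   [eps * t] keeps a witness within [t + eps * t = s]. *)
have /choice [pi piP] : forall k, exists i, (eps%:E * t <= lambda i)%E /\
    forall w, ((d (p k) w)%:E < t -> (d (p i) w)%:E < s)%E.
  move=> k; have [kt|[i it ki]] := near_large_radius fps (eps%:E * t) k.
    by exists k; split=> // w kw; exact: lt_le_trans ts.
  exists i; split=> // w kw; apply: (@le_lt_trans _ _ (d (p k) w + d (p k) (p i))%:E).
    by rewrite lee_fin addrC (dC (p k) (p i)).
  by rewrite EFinD /s (EFinD 1 eps) ge0_muleDl ?lee_fin ?ltW // mul1e lteD.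
have s_pi k : (s <= L (pi k))%E by apply: ge_scaled_radius => //; have [] := piP k.
have piS : contiguous (cech d p t) (sparse_dowker d p lambda phi eps s) pi pi.
  move=> u [w uw]; rewrite finset.setUid; exists w => _ _ /imsetP[k ku ->] /imsetP[l lu ->].
  have ks : ((d (p (pi k)) w)%:E < s)%E by have [_] := piP k; apply; exact: uw.
  rewrite !lt_min ks /=; apply/andP; split; first exact: lt_le_trans (s_pi k).
  (* The [phi]-condition is implied: [s <= L (pi l) <= L (phi (pi l))]. *)
  apply: lt_le_trans ks (le_trans (s_pi l) _); apply: L_anti; exact: phi_le.
have pi_id : contiguous (cech d p t) (cech d p s) pi id.
  move=> u [w uw]; exists w => k; rewrite imset_id inE => /orP[/imsetP[j ju ->]|ku].
    by have [_] := piP j; apply; exact: uw.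
  by apply: lt_le_trans ts; exact: uw.
have S_cech : sparse_dowker d p lambda phi eps t `<=` cech d p t.
  move=> u [w uw]; exists w => k ku.
  by have := uw k k ku ku; rewrite !lt_min => /and3P[].
have idS : contiguous (sparse_dowker d p lambda phi eps t)
    (sparse_dowker d p lambda phi eps s) id id.
  move=> u [w uw]; rewrite finset.setUid imset_id; exists w => k l ku lu.
  by have := uw k l ku lu; rewrite !lt_min => /andP[kt ->]; rewrite (lt_le_trans kt).
have piS' : contiguous (sparse_dowker d p lambda phi eps t)
    (sparse_dowker d p lambda phi eps s) pi pi by move=> u /S_cech; exact: piS.
pose r := retract phi lambda eps s n.+1.
have all_collapsed (g : 'I_n.+1 -> 'I_n.+1) k : collapsed phi lambda eps s n.+1 (g k).
  by move=> _; exact: ltn_ord.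
(* A simplex and its image under [pi] share a witness for the bounds by [s] and [L]; [r] then
   restores the [phi]-condition on their union. *)
have rpi_r : contiguous (sparse_dowker d p lambda phi eps t)
    (sparse_dowker d p lambda phi eps s) (r \o pi) (r \o id).
  move=> u [w uw]; rewrite (imset_comp r pi) (imset_comp r id) imset_id -imsetU.
  apply: (sparse_retract dm phi0 phi_lt L0 L_phi (w := w)).
  move=> k; rewrite inE => /orP[/imsetP[j ju ->]|ku].
    have := uw j j ju ju; rewrite !lt_min => /andP[jt _].
    have js : ((d (p (pi j)) w)%:E < s)%E by have [_] := piP j; apply.
    rewrite js /=; exact: lt_le_trans js (s_pi j).
  have := uw k k ku ku; rewrite !lt_min => /and3P[kt -> _].
  by rewrite (lt_le_trans kt).
have push_id_fun : push id = id :> ({ptws 'I_n.+1 -> R} -> _).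
  by apply/funext => x; exact: push_id.
exists (push pi); split; last split.
- split; first by apply: continuous_subspaceT; exact: continuous_push.
  (* Time 0 of the homotopy from [push pi] to itself shows that [push pi] lands in the target. *)
  have [H [_ HB H0 _]] :=
    contiguous_homotopic (R := R) (@sparse_down _ _ d _ p phi lambda eps s) piS.
  by move=> x Kx; rewrite -(H0 x Kx); apply: HB => //; rewrite lexx ler01.
- apply: homotopic_globW; rewrite -push_id_fun.
  apply: homotopic_glob_trans
    (retract_homotopic dm phi0 phi_lt L0 L_anti L_phi piS' (all_collapsed pi)) _.
  apply: homotopic_glob_trans
    (contiguous_homotopic (@sparse_down _ _ d _ p phi lambda eps s) rpi_r) _.
  apply: homotopic_glob_sym.
  exact: (retract_homotopic dm phi0 phi_lt L0 L_anti L_phi idS (all_collapsed id)).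
- apply: homotopic_globW; rewrite -push_id_fun.
  apply: contiguous_homotopic pi_id => u v /fintype.subsetP uv [w vw].
  by exists w => k ku; apply: vw; exact: uv.
Qed.
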